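(* Let $(A,\le,0,1)$ be a bounded MLUB-complete poset, $(T,R)$ a time frame with $R$ serial, $P,F,H,G$ the tense operators induced by $(T,R)$, and $C,D\in\mathcal P_+(A^T)$. Then: (i) if $C\subseteq D$ or $C\le_1D$, then $P(C)\le_2P(D)$ and $L(P(C))\subseteq L(P(D))$, and $F(C)\le_2F(D)$ and $L(F(C))\subseteq L(F(D))$; (ii) if $D\subseteq C$ or $C\le_2 D$, then $H(C)\le_1H(D)$ and $U(H(D))\subseteq U(H(C))$, and $G(C)\le_1G(D)$ and $U(G(D))\subseteq U(G(C))$; (iii) $H(C)\le P(C)$ and $G(C)\le F(C)$; (iv) $P(C)=P(LU(C))$, $F(C)=F(LU(C))$, $G(D)=G(UL(D))$, $H(D)=H(UL(D))$; (v) if $R$ is reflexive, then $H(C)\le C\le P(C)$ and $G(C)\le C\le F(C)$.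
   Context: For a poset and $X\subseteq A$: $L(X)$, $U(X)$ the sets of lower/upper bounds, $LU(X)=L(U(X))$, $UL(X)=U(L(X))$, $\operatorname{Max}X,\operatorname{Min}X$ the maximal/minimal elements. MLUB-complete: for every nonempty $M$, every upper bound of $M$ lies above a minimal upper bound and every lower bound below a maximal lower bound. $\mathcal P_+(X)$ = nonempty subsets. For subsets $X,Y$: $X\le Y$ iff $x\le y$ for all $x\in X,y\in Y$; $X\le_1Y$ iff every $x\in X$ lies below some $y\in Y$; $X\le_2Y$ iff every $y\in Y$ lies above some $x\in X$. $A^T$ is ordered componentwise and $L,U,\le,\le_1,\le_2$ on subsets of $A^T$ refer to this order; each $Z\in(\mathcal P_+A)^T$ is identified with the subset $\{q\in A^T\mid q(t)\in Z(t)\ \forall t\}$ of $A^T$. A time frame is $(T,R)$, $T\ne\emptyset$, $R\subseteq T^2$; serial: each $s$ has $r,t$ with $rRs$, $sRt$. The induced tense operators $P,F,H,G:\mathcal P_+(A^T)\to(\mathcal P_+A)^T$ are $P(B)(s)=\operatorname{Min}U(\{q(t)\mid q\in B,tRs\})$, $F(B)(s)=\operatorname{Min}U(\{q(t)\mid q\in B,sRt\})$, $H(B)(s)=\operatorname{Max}L(\{q(t)\mid q\in B,tRs\})$, $G(B)(s)=\operatorname{Max}L(\{q(t)\mid q\in B,sRt\})$. *)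

(* Defs.v *)
From mathcomp Require Export all_boot all_order all_classical.
Set Implicit Arguments.
Unset Strict Implicit.
Unset Printing Implicit Defensive.
Import Order.TTheory.
Local Open Scope classical_set_scope.
Local Open Scope order_scope.

(* L(X) and U(X) are [lbound X] and [ubound X]. On [T -> A] they refer to the
   componentwise order, the canonical porderType of a function type. *)

Definition MaxSet (d : Order.disp_t) (A : porderType d) (X : set A) : set A :=
  [set x | X x /\ forall y, X y -> x <= y -> y = x].

Definition MinSet (d : Order.disp_t) (A : porderType d) (X : set A) : set A :=
  [set x | X x /\ forall y, X y -> y <= x -> y = x].

Definition MLUB_complete (d : Order.disp_t) (A : porderType d) : Prop :=
  forall M : set A, M !=set0 ->
    (forall u, ubound M u -> exists2 m, MinSet (ubound M) m & m <= u) /\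
    (forall l, lbound M l -> exists2 m, MaxSet (lbound M) m & l <= m).

Definition le_sets (d : Order.disp_t) (A : porderType d) (X Y : set A) : Prop :=
  forall x y, X x -> Y y -> x <= y.

Definition le1_sets (d : Order.disp_t) (A : porderType d) (X Y : set A) : Prop :=
  forall x, X x -> exists2 y, Y y & x <= y.

Definition le2_sets (d : Order.disp_t) (A : porderType d) (X Y : set A) : Prop :=
  forall y, Y y -> exists2 x, X x & x <= y.

Definition serial (T : Type) (R : T -> T -> Prop) : Prop :=
  forall s, (exists r, R r s) /\ (exists t, R s t).

(* The subset of A^T with which a family Z of subsets of A is identified. *)
Definition box (T A : Type) (Z : T -> set A) : set (T -> A) :=
  [set q | forall t, Z t (q t)].

Section TenseOperators.
Variables (d : Order.disp_t) (A : porderType d) (T : Type) (R : T -> T -> Prop).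
Implicit Type B : set (T -> A).

Definition past_values B (s : T) : set A :=
  [set a | exists q t, [/\ B q, R t s & a = q t]].

Definition future_values B (s : T) : set A :=
  [set a | exists q t, [/\ B q, R s t & a = q t]].

(* The operators are defined on all subsets of A^T; nonempty arguments give
   families of nonempty sets under the assumptions of [tense_nonempty]. *)

Definition tenseP B : T -> set A := fun s => MinSet (ubound (past_values B s)).

Definition tenseF B : T -> set A := fun s => MinSet (ubound (future_values B s)).

Definition tenseH B : T -> set A := fun s => MaxSet (lbound (past_values B s)).

Definition tenseG B : T -> set A := fun s => MaxSet (lbound (future_values B s)).

End TenseOperators.

Lemma tense_nonempty (d : Order.disp_t) (A : tbPOrderType d) (T : Type)
    (R : T -> T -> Prop) (B : set (T -> A)) (s : T) :
  MLUB_complete A -> serial R -> B !=set0 ->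
  [/\ tenseP R B s !=set0, tenseF R B s !=set0,
      tenseH R B s !=set0 & tenseG R B s !=set0].
Proof.
move=> cA sR [q Bq]; have [[r rs] [t st]] := sR s.
have pN : past_values R B s !=set0 by exists (q r), q, r.
have fN : future_values R B s !=set0 by exists (q t), q, t.
have [pU pL] := cA _ pN; have [fU fL] := cA _ fN.
split.
- by have [|m mP _] := pU \top; [move=> x _; exact: lex1 | exists m].
- by have [|m mP _] := fU \top; [move=> x _; exact: lex1 | exists m].
- by have [|m mP _] := pL \bot; [move=> x _; exact: le0x | exists m].
- by have [|m mP _] := fL \bot; [move=> x _; exact: le0x | exists m].
Qed.

(* Main.v *)
Require Import Defs.
Set Implicit Arguments.
Unset Strict Implicit.
Unset Printing Implicit Defensive.
Import Order.TTheory.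
Local Open Scope classical_set_scope.

(** The operators depend on [B] only through the bounds of its past and future
    values, so (i) and (ii) reduce to comparing these bounds and choosing, at
    each time, a minimal upper (maximal lower) bound by MLUB-completeness.
    For (iv), an upper bound [u] of the values of [C] at the times [t R s] extends
    to an upper bound of [C] in [A^T] by the value [1] at the other times; hence
    [u] also bounds the values of [LU(C)].  The future operators of [R] are the
    past operators of the converse relation. *)

Section BoundsInPosets.
Local Open Scope order_scope.
Variables (d : Order.disp_t) (A : porderType d).
Implicit Types X Y : set A.

(** By reflexivity of the order. This reduces the inclusion alternative in (i) to the [le1_sets]
    one; the next lemma does the same for (ii). *)
Lemma subset_le1_sets X Y : X `<=` Y -> le1_sets X Y.
Proof. by move=> XY x /XY Yx; exists x. Qed.

Lemma subset_le2_sets X Y : Y `<=` X -> le2_sets X Y.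
Proof. by move=> YX y /YX Xy; exists y. Qed.

Lemma lbound_le2_sets X Y : le2_sets X Y -> lbound X `<=` lbound Y.
Proof. by move=> XY l lX y /XY[x /lX lx]; exact: le_trans. Qed.

Lemma ubound_le1_sets X Y : le1_sets X Y -> ubound Y `<=` ubound X.
Proof. by move=> XY u uY x /XY[y /uY yu] xy; exact: le_trans yu. Qed.

Lemma subset_lbound_ubound X : X `<=` lbound (ubound X).
Proof. by move=> x Xx u; exact. Qed.

Lemma subset_ubound_lbound X : X `<=` ubound (lbound X).
Proof. by move=> x Xx l; exact. Qed.

(** Any element of [X] links the two bounds; for empty [X] both sets of bounds would be all of
    [A]. *)
Lemma le_sets_lbound_ubound X : X !=set0 -> le_sets (lbound X) (ubound X).
Proof. by move=> [x Xx] l u /(_ _ Xx) lx /(_ _ Xx); exact: le_trans. Qed.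

End BoundsInPosets.

Section Boxes.
Local Open Scope order_scope.
Variables (d : Order.disp_t) (A : porderType d) (T : Type).
Implicit Types X Y : T -> set A.

(** The order is componentwise, so witnesses found separately at each time are glued into one
    function by the axiom of choice. *)
Lemma le2_sets_box X Y :
  (forall s, le2_sets (X s) (Y s)) -> le2_sets (box X) (box Y).
Proof.
move=> XY y Yy.
have /choice[x xP] : forall s, exists a, X s a /\ a <= y s.
  by move=> s; have [a] := XY s _ (Yy s); exists a.
by exists x; [move=> s; case: (xP s) | apply/lefP => s; case: (xP s)].
Qed.

Lemma le1_sets_box X Y :
  (forall s, le1_sets (X s) (Y s)) -> le1_sets (box X) (box Y).
Proof.
move=> XY x Xx.
have /choice[y yP] : forall s, exists a, Y s a /\ x s <= a.
  by move=> s; have [a] := XY s _ (Xx s); exists a.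
by exists y; [move=> s; case: (yP s) | apply/lefP => s; case: (yP s)].
Qed.

Lemma le_sets_box X Y :
  (forall s, le_sets (X s) (Y s)) -> le_sets (box X) (box Y).
Proof. by move=> XY x y Xx Yy; apply/lefP => s; exact: XY. Qed.

End Boxes.

Section MinMaxBounds.
Local Open Scope order_scope.
Variables (d : Order.disp_t) (A : porderType d).
Hypothesis cA : MLUB_complete A.
Implicit Types X Y : set A.

(** A minimal upper bound of [Y] is in particular an upper bound of [X], so completeness yields a
    minimal upper bound of [X] below it. *)
Lemma le2_sets_MinSet_ubound X Y : X !=set0 -> ubound Y `<=` ubound X ->
  le2_sets (MinSet (ubound X)) (MinSet (ubound Y)).
Proof. by move=> /cA[minX _] YX y [/YX/minX]. Qed.

Lemma le1_sets_MaxSet_lbound X Y : Y !=set0 -> lbound X `<=` lbound Y ->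
  le1_sets (MaxSet (lbound X)) (MaxSet (lbound Y)).
Proof. by move=> /cA[_ maxY] XY x [/XY/maxY]. Qed.

End MinMaxBounds.

Section PastValues.
Local Open Scope order_scope.
Variables (d : Order.disp_t) (A : tbPOrderType d) (T : Type).
Variable R : T -> T -> Prop.
Implicit Types B C D : set (T -> A).

Lemma past_values_nonempty B s :
  (exists r, R r s) -> B !=set0 -> past_values R B s !=set0.
Proof. by move=> [r rs] [q Bq]; exists (q r), q, r. Qed.

Lemma le1_sets_past_values C D s :
  le1_sets C D -> le1_sets (past_values R C s) (past_values R D s).
Proof.
move=> CD _ [q [t [/CD[p Dp /lefP qp] ts ->]]].
by exists (p t); [exists p, t | exact: qp].
Qed.

Lemma le2_sets_past_values C D s :
  le2_sets C D -> le2_sets (past_values R C s) (past_values R D s).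
Proof.
move=> CD _ [q [t [/CD[p Cp /lefP pq] ts ->]]].
by exists (p t); [exists p, t | exact: pq].
Qed.

Lemma ubound_past_values_LU C s :
  ubound (past_values R (lbound (ubound C)) s) = ubound (past_values R C s).
Proof.
apply/seteqP; split.
  apply: ubound_le1_sets; apply: le1_sets_past_values.
  exact/subset_le1_sets/subset_lbound_ubound.
move=> u uC _ [p [t [pLU ts ->]]].
(* [R] is an arbitrary relation, so the case distinction on [R t' s] is classical. *)
pose f t' := if `[< R t' s >] then u else \top.
have Uf : ubound C f.
  move=> q Cq; apply/lefP => t'; rewrite /f; case: asboolP => [t's|_].
    by apply: uC; exists q, t'.
  exact: lex1.
(* As [p] lies below every upper bound of [C], it lies below [f], and [f t] is [u] because
   [R t s]. *)
by have /lefP/(_ t) := pLU f Uf; rewrite /f asboolT.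
Qed.

Lemma lbound_past_values_UL C s :
  lbound (past_values R (ubound (lbound C)) s) = lbound (past_values R C s).
Proof.
apply/seteqP; split.
  apply: lbound_le2_sets; apply: le2_sets_past_values.
  exact/subset_le2_sets/subset_ubound_lbound.
move=> l lC _ [p [t [pUL ts ->]]].
(* Dually, [l] extends to a lower bound of [C] by the least element at the other times. *)
pose f t' := if `[< R t' s >] then l else \bot.
have Lf : lbound C f.
  move=> q Cq; apply/lefP => t'; rewrite /f; case: asboolP => [t's|_].
    by apply: lC; exists q, t'.
  exact: le0x.
by have /lefP/(_ t) := pUL f Lf; rewrite /f asboolT.
Qed.

End PastValues.

Section PastOperators.
Local Open Scope order_scope.
Variables (d : Order.disp_t) (A : tbPOrderType d) (T : Type).
Variable R : T -> T -> Prop.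
Hypotheses (cA : MLUB_complete A) (Rpast : forall s, exists r, R r s).
Implicit Types B C D : set (T -> A).

Lemma le2_sets_tenseP C D : C !=set0 -> le1_sets C D ->
  le2_sets (box (tenseP R C)) (box (tenseP R D)).
Proof.
move=> C0 CD; apply: le2_sets_box => s; apply: (le2_sets_MinSet_ubound cA).
  exact: past_values_nonempty.
exact/ubound_le1_sets/le1_sets_past_values.
Qed.

Lemma le1_sets_tenseH C D : D !=set0 -> le2_sets C D ->
  le1_sets (box (tenseH R C)) (box (tenseH R D)).
Proof.
move=> D0 CD; apply: le1_sets_box => s; apply: (le1_sets_MaxSet_lbound cA).
  exact: past_values_nonempty.
exact/lbound_le2_sets/le2_sets_past_values.
Qed.

Lemma le_sets_tenseH_tenseP C : C !=set0 ->
  le_sets (box (tenseH R C)) (box (tenseP R C)).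
Proof.
move=> C0; apply: le_sets_box => s l u [lC _] [uC _].
exact: le_sets_lbound_ubound (past_values_nonempty (Rpast s) C0) _ _ lC uC.
Qed.

Lemma tenseP_LU C : tenseP R C = tenseP R (lbound (ubound C)).
Proof. by apply/funext => s; rewrite /tenseP ubound_past_values_LU. Qed.

Lemma tenseH_UL C : tenseH R C = tenseH R (ubound (lbound C)).
Proof. by apply/funext => s; rewrite /tenseH lbound_past_values_UL. Qed.

Hypothesis Rrefl : forall s, R s s.

(** By reflexivity, [q s] is itself among the past values at [s]. *)
Lemma le_sets_tenseP_refl C : le_sets C (box (tenseP R C)).
Proof.
move=> q u Cq uC; apply/lefP => s; have [ub _] := uC s.
by apply: ub; exists q, s.
Qed.

Lemma le_sets_tenseH_refl C : le_sets (box (tenseH R C)) C.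
Proof.
move=> l q lC Cq; apply/lefP => s; have [lb _] := lC s.
by apply: lb; exists q, s.
Qed.

End PastOperators.

Theorem theorem3p11 (d : Order.disp_t) (A : tbPOrderType d)
    (T : Type) (R : T -> T -> Prop) (C D : set (T -> A)) :
  MLUB_complete A -> inhabited T -> serial R ->
  C !=set0 -> D !=set0 ->
  let P := tenseP R in let F := tenseF R in
  let H := tenseH R in let G := tenseG R in
  [/\ (* (i) *)
      C `<=` D \/ le1_sets C D ->
      [/\ le2_sets (box (P C)) (box (P D)),
          lbound (box (P C)) `<=` lbound (box (P D)),
          le2_sets (box (F C)) (box (F D)) &
          lbound (box (F C)) `<=` lbound (box (F D))],
      (* (ii) *)
      D `<=` C \/ le2_sets C D ->
      [/\ le1_sets (box (H C)) (box (H D)),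
          ubound (box (H D)) `<=` ubound (box (H C)),
          le1_sets (box (G C)) (box (G D)) &
          ubound (box (G D)) `<=` ubound (box (G C))],
      (* (iii) *)
      le_sets (box (H C)) (box (P C)) /\ le_sets (box (G C)) (box (F C)),
      (* (iv) *)
      [/\ P C = P (lbound (ubound C)),
          F C = F (lbound (ubound C)),
          G D = G (ubound (lbound D)) &
          H D = H (ubound (lbound D))] &
      (* (v) *)
      (forall s, R s s) ->
      [/\ le_sets (box (H C)) C, le_sets C (box (P C)),
          le_sets (box (G C)) C & le_sets C (box (F C))]].
Proof.
move=> cA _ sR C0 D0 P F H G.
pose Rc s t := R t s.
(* Each half of seriality supplies predecessors for one of the relations [R] and [Rc]. *)
have Rpast s : exists r, R r s by case: (sR s).
have Rcpast s : exists r, Rc r s by case: (sR s).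
(* The future values for [R] and the past values for [Rc] agree by conversion. *)
have FE : F = tenseP Rc by [].
have GE : G = tenseH Rc by [].
rewrite FE GE /P /H; split.
- move=> CD'; have CD : le1_sets C D by case: CD' => // /subset_le1_sets.
  (* The inclusions of lower bounds follow from the [le2_sets] comparisons of the boxes. *)
  by split; do ?apply: lbound_le2_sets; exact: le2_sets_tenseP.
- move=> CD'; have CD : le2_sets C D by case: CD' => // /subset_le2_sets.
  by split; do ?apply: ubound_le1_sets; exact: le1_sets_tenseH.
- by split; exact: le_sets_tenseH_tenseP.
- by split; do ?[exact: tenseP_LU | exact: tenseH_UL].
- move=> Rrefl.
  by split; do ?[exact: le_sets_tenseH_refl | exact: le_sets_tenseP_refl].
Qed.
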